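(* For integers $r,n\ge 0$ let $h_r(n)$ denote the number of permutations in $S_n$ that avoid the generalized pattern $21\text{-}3$ and contain exactly $r$ occurrences of the generalized pattern $13\text{-}2$, and let $H_r(x)=\sum_{n\ge 0} h_r(n)x^n$. Then for every integer $r\ge 0$, $$H_r(x)=\frac{1-x}{1-2x}\,\delta_{r,0}+\frac{x^2}{1-2x}\sum_{d=1}^{r}\frac{H_{r-d}(x)-\sum_{j=0}^{d-1}h_{r-d}(j)x^j}{(1-x)^d}.$$
   Context: $S_n$ is the set of permutations $\pi=\pi_1\pi_2\cdots\pi_n$ of $\{1,\dots,n\}$; $S_0$ consists of the empty permutation only. An occurrence of a generalized pattern $ab\text{-}c$ (with $abc$ a permutation of $\{1,2,3\}$) in $\pi$ is a pair $(i,j)$ with $i+1<j\le n$ such that $(\pi_i,\pi_{i+1},\pi_j)$ is order-isomorphic to $(a,b,c)$ (so the first two letters are adjacent in $\pi$). $\pi$ avoids the pattern if it has no occurrence of it. $\delta_{r,0}$ is the Kronecker delta. The identity is one of formal power series. *)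

(* Defs.v *)
From HB Require Import structures.
From mathcomp Require Import all_boot all_order all_algebra all_fingroup.
From mathcomp Require Import boolp.

Set Implicit Arguments.
Unset Strict Implicit.
Unset Printing Implicit Defensive.

Import GRing.Theory.

(** * Formal power series *)

Record fps (R : Type) := Fps { coefs : nat -> R }.

Lemma fpsP (R : Type) (f g : fps R) : (forall n, coefs f n = coefs g n) -> f = g.
Proof. by case: f g => [f] [g] /= /funext ->. Qed.

(* Equality of power series is not decidable, hence the classical mixins. *)
HB.instance Definition _ (R : Type) := gen_eqMixin (fps R).
HB.instance Definition _ (R : Type) := gen_choiceMixin (fps R).

Local Open Scope ring_scope.

Section FpsRing.
Variable R : comNzRingType.
Implicit Types f g h : fps R.

Definition fps_zero : fps R := Fps (fun=> 0).
Definition fps_opp f := Fps (fun n => - coefs f n).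
Definition fps_add f g := Fps (fun n => coefs f n + coefs g n).

Fact fps_addA : associative fps_add.
Proof. by move=> f g h; apply: fpsP => n /=; rewrite addrA. Qed.
Fact fps_addC : commutative fps_add.
Proof. by move=> f g; apply: fpsP => n /=; rewrite addrC. Qed.
Fact fps_add0 : left_id fps_zero fps_add.
Proof. by move=> f; apply: fpsP => n /=; rewrite add0r. Qed.
Fact fps_addN : left_inverse fps_zero fps_opp fps_add.
Proof. by move=> f; apply: fpsP => n /=; rewrite addNr. Qed.

HB.instance Definition _ := GRing.isZmodule.Build (fps R)
  fps_addA fps_addC fps_add0 fps_addN.

Definition fps_one : fps R := Fps (fun n => (n == 0%N)%:R).
Definition fps_mul f g :=
  Fps (fun n => \sum_(i < n.+1) coefs f i * coefs g (n - i)).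

Definition fps_trunc n f : {poly R} := \poly_(i < n.+1) coefs f i.

Lemma coef_fps_trunc n f i : (i <= n)%N -> (fps_trunc n f)`_i = coefs f i.
Proof. by move=> le_in; rewrite coef_poly ltnS le_in. Qed.

Lemma coefs_mul_trunc n f g i : (i <= n)%N ->
  coefs (fps_mul f g) i = (fps_trunc n f * fps_trunc n g)`_i.
Proof.
move=> le_in; rewrite coefM; apply: eq_bigr => j _.
by rewrite !coef_fps_trunc // ?(leq_trans (leq_subr _ _)) //
  (leq_trans _ le_in) // -ltnS.
Qed.

Fact fps_mulC : commutative fps_mul.
Proof. by move=> f g; apply: fpsP => n; rewrite !(@coefs_mul_trunc n) // mulrC. Qed.

Fact fps_mulA : associative fps_mul.
Proof.
move=> f g h; apply: fpsP => n.
have mul3 (a b c : fps R) : coefs (fps_mul (fps_mul a b) c) n =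
    (fps_trunc n a * fps_trunc n b * fps_trunc n c)`_n.
  rewrite coefM; apply: eq_bigr => j _.
  have le_jn : (j <= n)%N by rewrite -ltnS.
  by rewrite (coefs_mul_trunc _ _ le_jn) coef_fps_trunc // leq_subr.
by rewrite (fps_mulC f) !mul3 mulrC mulrA.
Qed.

Fact fps_mul1 : left_id fps_one fps_mul.
Proof.
move=> f; apply: fpsP => n /=.
by rewrite big_ord_recl /= mul1r subn0 big1 ?addr0 // => i _; rewrite mul0r.
Qed.

Fact fps_mulD : left_distributive fps_mul fps_add.
Proof.
move=> f g h; apply: fpsP => n /=.
by rewrite -big_split; apply: eq_bigr => i _; rewrite mulrDl.
Qed.

Fact fps_one_neq0 : fps_one != 0.
Proof. by apply/eqP => /(congr1 (fun f => coefs f 0)) /eqP; rewrite oner_eq0. Qed.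

HB.instance Definition _ := GRing.Zmodule_isComNzRing.Build (fps R)
  fps_mulA fps_mulC fps_mul1 fps_mulD fps_one_neq0.

Definition fpsX : fps R := Fps (fun n => (n == 1%N)%:R).

Lemma coefs0 n : coefs (0 : fps R) n = 0. Proof. by []. Qed.
Lemma coefs1 n : coefs (1 : fps R) n = (n == 0%N)%:R. Proof. by []. Qed.
Lemma coefsN f n : coefs (- f) n = - coefs f n. Proof. by []. Qed.
Lemma coefsD f g n : coefs (f + g) n = coefs f n + coefs g n. Proof. by []. Qed.
Lemma coefsB f g n : coefs (f - g) n = coefs f n - coefs g n. Proof. by []. Qed.
Lemma coefsM f g n :
  coefs (f * g) n = \sum_(i < n.+1) coefs f i * coefs g (n - i).
Proof. by []. Qed.

Lemma coefs_sum (I : Type) (s : seq I) (P : pred I) (F : I -> fps R) n :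
  coefs (\sum_(i <- s | P i) F i) n = \sum_(i <- s | P i) coefs (F i) n.
Proof. exact: (big_morph (fun f => coefs f n)). Qed.

Lemma coefsX_lt f k n : coefs f 0 = 0 -> (n < k)%N -> coefs (f ^+ k) n = 0.
Proof.
move=> f0; elim: k n => // k IHk n ltnk; rewrite exprS coefsM big1 // => i _.
have [i0|i_gt0] := posnP i; first by rewrite i0 f0 mul0r.
rewrite IHk ?mulr0 // ltn_subLR; last by rewrite -ltnS.
by rewrite (leq_trans ltnk) // -addn1 addnC leq_add2r.
Qed.

End FpsRing.

Section FpsUnitRing.
Variable R : comUnitRingType.
Implicit Types f g : fps R.

Definition fps_unit : {pred fps R} := [pred f | coefs f 0 \is a GRing.unit].

(* With f_0 invertible, f = f_0 (1 - u) where u has no constant term, so that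
   1/f = f_0^-1 (1 + u + u^2 + ...); the coefficient of x^n involves only the
   powers of u up to u^n. *)
Definition fps_geom f : fps R :=
  let c := (coefs f 0)^-1 in
  let u : fps R := 1 - Fps (fun n => c * coefs f n) in
  Fps (fun n => c * coefs (\sum_(k < n.+1) u ^+ k) n).

(* As usual in MathComp, the inverse of a non-unit is itself. *)
Definition fps_inv f := if f \in fps_unit then fps_geom f else f.

Fact fps_mulV : {in fps_unit, left_inverse 1 fps_inv *%R}.
Proof.
move=> f uf; rewrite /fps_inv uf; apply: fpsP => n.
set c := (coefs f 0)^-1; pose v : fps R := Fps (fun n => c * coefs f n).
pose u : fps R := 1 - v.
have u0 : coefs u 0 = 0 by rewrite coefsB /= mulVr // subrr.
have -> : coefs (fps_geom f * f) n = coefs ((\sum_(k < n.+1) u ^+ k) * v) n.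
  rewrite !coefsM; apply: eq_bigr => i _ /=; rewrite -/c -/v -/u mulrCA mulrA.
  congr (_ * _ * _); rewrite !coefs_sum.
  rewrite (big_ord_widen n.+1 (fun k => coefs (u ^+ k) i)) // big_mkcond /=.
  apply: eq_bigr => k _; case: ifP => // /negbT; rewrite -leqNgt => lt_ik.
  by rewrite coefsX_lt.
have -> : v = 1 - u by rewrite opprB addrC subrK.
rewrite mulrC -opprB mulNr -subrX1 opprB coefsB coefsX_lt // subr0.
by [].
Qed.

Fact fps_unitPl f g : g * f = 1 -> f \in fps_unit.
Proof.
move/(congr1 (fun h => coefs h 0)); rewrite coefsM big_ord1 /= => gf1.
by apply/unitrPr; exists (coefs g 0); rewrite mulrC.
Qed.

Fact fps_inv_out : {in [predC fps_unit], fps_inv =1 id}.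
Proof. by move=> f /negbTE uf; rewrite /fps_inv uf. Qed.

HB.instance Definition _ := GRing.ComNzRing_hasMulInverse.Build (fps R)
  fps_mulV fps_unitPl fps_inv_out.

Lemma fps_unitE f : (f \is a GRing.unit) = (coefs f 0 \is a GRing.unit).
Proof. by []. Qed.

End FpsUnitRing.

(** * Generalized patterns *)

Local Open Scope nat_scope.

(* The word pi_1 ... pi_n, with letters in {1, ..., n}; it is read by [nth]
   from position 0, so that pi_i is [nth 0 (oneline s) i.-1]. *)
Definition oneline (n : nat) (s : 'S_n) : seq nat :=
  [seq (nat_of_ord (s i)).+1 | i <- enum 'I_n].

Definition order_isomorphic (u v : seq nat) : bool :=
  (size u == size v) &&
  [forall k : 'I_(size u), forall l : 'I_(size u),
     (nth 0 u k < nth 0 u l) == (nth 0 v k < nth 0 v l)].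

(* Occurrences of the pattern ab-c, as pairs of positions counted from 0. *)
Definition occurrences (a b c n : nat) (s : 'S_n) : {set 'I_n * 'I_n} :=
  let w := oneline s in
  [set ij : 'I_n * 'I_n |
    (ij.1.+1 < ij.2) &&
    order_isomorphic [:: nth 0 w ij.1; nth 0 w ij.1.+1; nth 0 w ij.2]
                     [:: a; b; c]].

Definition avoids (a b c n : nat) (s : 'S_n) : bool :=
  occurrences a b c s == set0.

Definition h (r n : nat) : nat :=
  #|[set s : 'S_n | avoids 2 1 3 s & #|occurrences 1 3 2 s| == r]|.

Definition H (r : nat) : fps rat := Fps (fun n => (h r n)%:R%R).

(* Main.v *)
(** Let P_n(q) be the sum of q^(occurrences of 13-2) over the permutations in
    S_n avoiding 21-3.  Inserting a first letter a before such a permutation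
    with first letter b preserves avoidance iff a is the new maximum or a <= b;
    it creates b - a occurrences of 13-2 in the second case and none in the
    first.  Hence, if B(n, a) is the sum of q^(occurrences + b - a) over
    those permutations in S_(n+1) whose first letter b (counted from 0) is
    at least a, then P_(n+2) = P_(n+1) + sum_(a <= n) B(n, a), and splitting
    off the case b = a gives a Pascal recurrence for B, whose solution is
    B(m + j, m) = sum_d C(j, d) q^d P_(m+d).  The generating functions then
    come from 1/(1-x)^(d+1) = sum_n C(n+d, d) x^n. *)

Require Import Defs.
From mathcomp Require Import all_boot all_order all_algebra all_fingroup.
From mathcomp Require Import zify ring.

Set Implicit Arguments.
Unset Strict Implicit.
Unset Printing Implicit Defensive.

Import GRing.Theory Num.Theory.

(** * Patterns as inequalities between letters, and counting by value *)

Lemma order_isomorphic132 x y z :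
  order_isomorphic [:: x; y; z] [:: 1; 3; 2] = (x < z < y).
Proof.
apply/idP/idP=> [/andP[_ /forallP H]|lt_xzy].
  have /forallP /(_ (@Ordinal 3 2 isT)) /eqP /= := H (@Ordinal 3 0 isT).
  have /forallP /(_ (@Ordinal 3 1 isT)) /eqP /= := H (@Ordinal 3 2 isT).
  by move=> -> ->.
apply/forallP => -[[|[|[|//]]] ?]; apply/forallP => -[[|[|[|//]]] ?] /=; lia.
Qed.

Lemma order_isomorphic213 x y z :
  order_isomorphic [:: x; y; z] [:: 2; 1; 3] = (y < x < z).
Proof.
apply/idP/idP=> [/andP[_ /forallP H]|lt_yxz].
  have /forallP /(_ (@Ordinal 3 0 isT)) /eqP /= := H (@Ordinal 3 1 isT).
  have /forallP /(_ (@Ordinal 3 2 isT)) /eqP /= := H (@Ordinal 3 0 isT).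
  by move=> -> ->.
apply/forallP => -[[|[|[|//]]] ?]; apply/forallP => -[[|[|[|//]]] ?] /=; lia.
Qed.

Lemma nth_oneline n (s : 'S_n) (i : 'I_n) : nth 0 (oneline s) i = (s i).+1.
Proof. by rewrite (nth_map i) ?nth_ord_enum // size_enum_ord. Qed.

Lemma nth_oneline_lift0 n (a : 'I_n.+1) (s : 'S_n) :
  nth 0 (oneline (lift_perm ord0 a s)) 0 = a.+1.
Proof. by rewrite (nth_oneline _ ord0) lift_perm_id. Qed.

Lemma nth_oneline_liftS n (a : 'I_n.+1) (s : 'S_n) k : k < n ->
  nth 0 (oneline (lift_perm ord0 a s)) k.+1 = bump a.+1 (nth 0 (oneline s) k).
Proof.
move=> lt_kn; have /= -> := nth_oneline s (Ordinal lt_kn).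
by rewrite (nth_oneline _ (lift ord0 (Ordinal lt_kn))) lift_perm_lift /= bumpS.
Qed.

Lemma ltn_bump2 a x y : (bump a x < bump a y) = (x < y).
Proof. by rewrite !ltnNge leq_bump2. Qed.

Lemma card_occurrences a b c n (s : 'S_n) :
  #|occurrences a b c s| =
  \sum_(i < n) \sum_(j < n) (i.+1 < j) &&
    order_isomorphic [:: nth 0 (oneline s) i; nth 0 (oneline s) i.+1;
                         nth 0 (oneline s) j] [:: a; b; c].
Proof.
rewrite -sum1dep_card pair_bigA /= big_mkcond /=.
by apply: eq_bigr => ij _; case: ifP.
Qed.

Lemma sum_interval n p q : \sum_(j < n) (p <= j < q) = minn n q - p.
Proof. by elim: n => [|n IHn]; rewrite ?big_ord0 ?big_ord_recr /= ?IHn; lia. Qed.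

Lemma sum_perm_interval n (s : 'S_n) p q :
  \sum_(j < n) (p <= s j < q) = minn n q - p.
Proof.
rewrite -sum_interval [RHS](reindex_inj (@perm_inj _ s)).
exact: eq_bigr.
Qed.

(** * Inserting a first letter *)

Section Insertion.
Variables (n : nat) (a : 'I_n.+2) (s : 'S_n.+1).

(** Occurrences avoiding position 0 are those of [s], as [bump] preserves order. One starting at
    position 0 uses the old first letter next, so only its third position [j] is free. *)
Lemma card_occurrences_lift p q r u :
    (forall x y z, order_isomorphic [:: bump a.+1 x; bump a.+1 y; bump a.+1 z]
       [:: p; q; r] = order_isomorphic [:: x; y; z] [:: p; q; r]) ->
    (forall j : 'I_n.+1, (0 < j) &&
       order_isomorphic [:: a.+1; bump a.+1 (s ord0).+1; bump a.+1 (s j).+1]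
         [:: p; q; r] = u j) ->
  #|occurrences p q r (lift_perm ord0 a s)| =
  #|occurrences p q r s| + \sum_(j < n.+1) u j.
Proof.
move=> bump_iso Eu; rewrite !card_occurrences big_ord_recl addnC; congr (_ + _).
  apply: eq_bigr => i _; rewrite big_ord_recl add0n; apply: eq_bigr => j _ /=.
  rewrite /bump !add1n ltnS; case: ltnP => //= lt_ij.
  have lt_in := ltn_trans lt_ij (ltn_ord j).
  by rewrite !nth_oneline_liftS ?bump_iso.
rewrite big_ord_recl add0n; apply: eq_bigr => j _ /=.
rewrite /bump !add1n ltnS -Eu nth_oneline_lift0 !nth_oneline_liftS //.
by rewrite !(nth_oneline s ord0) nth_oneline.
Qed.

Lemma card_occurrences132_lift :
  #|occurrences 1 3 2 (lift_perm ord0 a s)| =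
  #|occurrences 1 3 2 s| + (s ord0 - a).
Proof.
rewrite (@card_occurrences_lift _ _ _ (fun j => a <= s j < s ord0)).
- by rewrite sum_perm_interval (minn_idPr _) // ltnW.
- by move=> x y z; rewrite !order_isomorphic132 !ltn_bump2.
move=> j; rewrite order_isomorphic132 ltn_bump2 ltnS.
(* At [j = 0] both sides fail: [s j < s ord0] is strict. *)
have [j0|j_gt0] := posnP j; last by rewrite /bump; lia.
by rewrite (_ : j = ord0) ?ltnn ?andbF //; apply: val_inj.
Qed.

(** A new 21-3 needs a descent [s ord0 < a] and a later letter above [a]; the latter exists unless
    [a] is the maximum. *)
Lemma avoids213_lift :
  avoids 2 1 3 (lift_perm ord0 a s) =
  avoids 2 1 3 s && ((a == n.+1 :> nat) || (a <= s ord0)).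
Proof.
rewrite /avoids -!cards_eq0.
(* The bound [n.+1] gives the interval form of [sum_perm_interval]. *)
rewrite (@card_occurrences_lift _ _ _ (fun j => (s ord0 < a) && (a <= s j < n.+1))).
- rewrite addn_eq0; congr (_ && _).
  under eq_bigr => j _ do rewrite -mulnb.
  rewrite -big_distrr /= sum_perm_interval minnn.
  by have := ltn_ord a; case: ltnP => /=; lia.
- by move=> x y z; rewrite !order_isomorphic213 !ltn_bump2.
move=> j; rewrite order_isomorphic213 ltn_ord andbT.
have [j0|j_gt0] := posnP j; last by rewrite /bump; lia.
by rewrite (_ : j = ord0) /=; [lia | apply: val_inj].
Qed.

End Insertion.

Lemma lift_perm_bij n :
  bijective (fun p : 'I_n.+1 * 'S_n => lift_perm ord0 p.1 p.2).
Proof.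
(* Surjectivity follows by counting: (n+1) n! = (n+1)!. *)
apply: inj_card_bij => [[a s] [b t] /= /permP Est|].
  have Eab: a = b by have := Est ord0; rewrite !lift_perm_id.
  rewrite Eab in Est *; congr (_, _); apply/permP => k.
  by have := Est (lift ord0 k); rewrite !lift_perm_lift => /lift_inj.
by rewrite card_prod card_ord !card_Sn factS.
Qed.

Lemma sum_perm_recl (V : nmodType) n (Q : pred 'S_n.+1) (F : 'S_n.+1 -> V) :
  (\sum_(t | Q t) F t =
   \sum_(a < n.+1) \sum_(s | Q (lift_perm ord0 a s)) F (lift_perm ord0 a s))%R.
Proof.
rewrite (reindex _ (onW_bij _ (lift_perm_bij n))) pair_big_dep /=.
exact: eq_bigl.
Qed.

Local Open Scope ring_scope.

(** * The polynomials P_n ([occ132_poly]) and B(n, a) ([occ132_poly_ge]), with ['X] as q *)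

Definition occ132_poly n : {poly rat} :=
  \sum_(s : 'S_n | avoids 2 1 3 s) 'X^#|occurrences 1 3 2 s|.

Definition occ132_poly_first n (a : nat) : {poly rat} :=
  \sum_(s : 'S_n.+1 | avoids 2 1 3 s && (s ord0 == a :> nat))
     'X^#|occurrences 1 3 2 s|.

(* The exponent is the number of occurrences of 13-2 in the permutation obtained
   from [s] by inserting the first letter [a]; see [card_occurrences132_lift]. *)
Definition occ132_poly_ge n (a : nat) : {poly rat} :=
  \sum_(s : 'S_n.+1 | avoids 2 1 3 s && (a <= s ord0)%N)
     'X^(#|occurrences 1 3 2 s| + (s ord0 - a)).

Lemma coef_occ132_poly n r : (occ132_poly n)`_r = (h r n)%:R.
Proof.
rewrite coef_sum /h -sum1dep_card natr_sum big_mkcondr /=.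
by apply: eq_bigr => s _; rewrite coefXn eq_sym; case: eqP.
Qed.

Lemma occ132_polyE n :
  occ132_poly n.+1 = \sum_(a < n.+1) occ132_poly_first n a.
Proof.
by rewrite /occ132_poly (partition_big (fun s : 'S_n.+1 => s ord0) xpredT).
Qed.

Lemma occ132_poly_firstE n (a : 'I_n.+1) :
  occ132_poly_first n a =
  \sum_(s : 'S_n | avoids 2 1 3 (lift_perm ord0 a s))
     'X^#|occurrences 1 3 2 (lift_perm ord0 a s)|.
Proof.
rewrite /occ132_poly_first sum_perm_recl (bigD1 a) //= [X in _ + X]big1 ?addr0.
  by apply: eq_bigl => s; rewrite lift_perm_id eqxx andbT.
move=> b /negbTE neq_ba; rewrite big_pred0 // => s.
by rewrite lift_perm_id val_eqE neq_ba andbF.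
Qed.

Lemma occ132_poly_first_max n : occ132_poly_first n n = occ132_poly n.
Proof.
(* The insertion lemmas presuppose an old first letter, so [n = 0] is checked directly. *)
rewrite (occ132_poly_firstE ord_max); case: n => [|n].
  apply: eq_big => s; rewrite /avoids -!cards_eq0 !card_occurrences.
    by rewrite !big_ord_recl !big_ord0.
  by rewrite !big_ord_recl !big_ord0.
apply: eq_big => s; first by rewrite avoids213_lift eqxx andbT.
by rewrite card_occurrences132_lift /= (eqnP (ltnW (ltn_ord _))) addn0.
Qed.

Lemma occ132_poly_first_ge n a : (a <= n)%N ->
  occ132_poly_first n.+1 a = occ132_poly_ge n a.
Proof.
move=> le_an; have lt_an : (a < n.+2)%N by lia.
rewrite (occ132_poly_firstE (Ordinal lt_an)).
apply: eq_big => s; last by rewrite card_occurrences132_lift.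
by rewrite avoids213_lift /= ltn_eqF.
Qed.

(** If the first letter exceeds [a], measuring from [a.+1] lowers the exponent by one, hence the
    factor ['X]. *)
Lemma occ132_poly_ge_rec n a :
  occ132_poly_ge n a = occ132_poly_first n a + 'X * occ132_poly_ge n a.+1.
Proof.
rewrite /occ132_poly_ge (bigID (fun s : 'S_n.+1 => s ord0 == a :> nat)) /=.
congr (_ + _).
  apply: eq_big => s; last by move=> /andP[_ /eqP ->]; rewrite subnn addn0.
  by rewrite -andbA; case: eqP => [->|]; rewrite ?leqnn ?andbF.
rewrite mulr_sumr; apply: eq_big => s.
  by rewrite -andbA ltn_neqAle [a == _]eq_sym [(_ != _) && _]andbC.
by move=> /andP[/andP[_ ?] ?]; rewrite -exprS; congr ('X^_); lia.
Qed.

Lemma occ132_poly_ge0 n a : (n < a)%N -> occ132_poly_ge n a = 0.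
Proof.
by move=> lt_na; rewrite /occ132_poly_ge big_pred0 // => s;
  have := ltn_ord (s ord0); lia.
Qed.

Lemma occ132_poly_geE m j :
  occ132_poly_ge (m + j) m =
  \sum_(d < j.+1) occ132_poly (m + d) *+ 'C(j, d) * 'X^d.
Proof.
elim: j m => [|j IHj] m.
  rewrite occ132_poly_ge_rec occ132_poly_ge0 // ?addn0 // mulr0 addr0.
  by rewrite big_ord1 addn0 occ132_poly_first_max bin0 mulr1.
(* The two terms become B(m + j, m) and q B(m + 1 + j, m + 1), both with gap [j]; Pascal's rule
   merges their expansions. *)
rewrite occ132_poly_ge_rec addnS occ132_poly_first_ge ?leq_addr // -addSn.
rewrite !IHj [RHS]big_ord_recl [X in X + _]big_ord_recl /= !bin0 -addrA.
congr (_ + _); under [in RHS]eq_bigr => d _ do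
  rewrite /bump /= add1n binS mulrnDr mulrDl.
rewrite big_split /=; congr (_ + _).
  by rewrite [RHS]big_ord_recr /= bin_small // mulr0n mul0r addr0.
rewrite mulr_sumr; apply: eq_bigr => d _.
by rewrite exprS mulrCA addnS.
Qed.

(** Both ranges are [d <= minn m n]. This frees the range of [d] from [a] before sums are
    exchanged. *)
Lemma sum_ord_swap_bound (V : nmodType) (F : nat -> V) m n :
  \sum_(d < m.+1 | (d <= n)%N) F d = \sum_(d < n.+1 | (d <= m)%N) F d.
Proof.
rewrite (big_ord_widen_cond (m + n).+1 (fun d => d <= n)%N F) ?ltnS ?leq_addr //.
rewrite (big_ord_widen_cond (m + n).+1 (fun d => d <= m)%N F) ?ltnS ?leq_addl //.
by apply: eq_bigl => d; rewrite !ltnS andbC.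
Qed.

Lemma h_rec r n :
  h r n.+2 = (h r n.+1 +
    \sum_(a < n.+1) \sum_(d < (n - a).+1 | (d <= r)%N)
      h (r - d) (a + d) * 'C(n - a, d))%N.
Proof.
apply/eqP; rewrite -(eqr_nat rat) -coef_occ132_poly occ132_polyE.
rewrite big_ord_recr /= occ132_poly_first_max coefD coef_occ132_poly addrC natrD.
apply/eqP; congr (_ + _); rewrite coef_sum natr_sum.
apply: eq_bigr => a _; have le_an : (a <= n)%N by rewrite -ltnS.
rewrite occ132_poly_first_ge // -{1}(subnKC le_an) occ132_poly_geE coef_sum.
rewrite natr_sum [RHS]big_mkcond; apply: eq_bigr => d _.
rewrite coefMXn ltnNge; case: leqP => //= le_dr.
by rewrite coefMn coef_occ132_poly natrM mulr_natr.
Qed.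

Lemma occ132_poly0 : occ132_poly 0 = 1.
Proof.
rewrite -[RHS]/(0`!%:R) -card_Sn -sumr_const /occ132_poly.
apply: eq_big => s; last by rewrite card_occurrences big_ord0.
by rewrite [RHS]inE /avoids -cards_eq0 card_occurrences big_ord0.
Qed.

Lemma h0 r : h r 0 = (r == 0)%N.
Proof. by apply/eqP; rewrite -(eqr_nat rat) -coef_occ132_poly occ132_poly0 coef1. Qed.

Lemma h1 r : h r 1 = h r 0.
Proof.
apply/eqP; rewrite -(eqr_nat rat) -!coef_occ132_poly occ132_polyE big_ord1.
by rewrite occ132_poly_first_max.
Qed.

(** * Coefficients of power series *)

Section PowerSeries.
Variable R : comUnitRingType.
Implicit Types f : fps R.
Local Notation x := (fpsX R).

Lemma coefsMn f c n : coefs (c%:R * f) n = c%:R * coefs f n.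
Proof.
elim: c => [|c IHc]; first by rewrite !mul0r.
by rewrite !mulrS !mulrDl coefsD IHc !mul1r.
Qed.

Lemma coefsXM0 f : coefs (x * f) 0 = 0.
Proof. by rewrite coefsM big_ord1 mul0r. Qed.

Lemma coefsXMS f n : coefs (x * f) n.+1 = coefs f n.
Proof.
rewrite coefsM big_ord_recl mul0r add0r big_ord_recl mul1r subSS subn0.
by rewrite big1 ?addr0 // => i _; rewrite mul0r.
Qed.

Lemma coefsXn d n : coefs (x ^+ d) n = (n == d)%:R.
Proof.
elim: d n => [|d IHd] [|n] //; rewrite exprS; first by rewrite coefsXM0.
by rewrite coefsXMS IHd.
Qed.

Lemma coefs_1BXM0 f : coefs ((1 - x) * f) 0 = coefs f 0.
Proof. by rewrite mulrBl mul1r coefsB coefsXM0 subr0. Qed.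

Lemma coefs_1BXMS f n :
  coefs ((1 - x) * f) n.+1 = coefs f n.+1 - coefs f n.
Proof. by rewrite mulrBl mul1r coefsB coefsXMS. Qed.

Lemma unit_1BX : 1 - x \is a GRing.unit.
Proof. by rewrite fps_unitE coefsB subr0 unitr1. Qed.

Lemma unit_1B2X : 1 - 2%:R * x \is a GRing.unit.
Proof. by rewrite fps_unitE coefsB coefsMn mulr0 subr0 unitr1. Qed.

Lemma coefs_inv_1BX d n : coefs ((1 - x) ^- d.+1) n = 'C(n + d, d)%:R.
Proof.
suff -> : (1 - x) ^- d.+1 = Fps (fun n => 'C(n + d, d)%:R : R) by [].
apply: (mulrI (unitrX d.+1 unit_1BX)); rewrite divrr ?unitrX ?unit_1BX //.
(* By Pascal's rule a factor 1 - x lowers [d] by one, down to the geometric series. *)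
elim: d => [|d IHd].
  apply: fpsP => -[|m]; first by rewrite expr1 coefs_1BXM0 /= bin0.
  by rewrite expr1 coefs_1BXMS /= !bin0 subrr.
rewrite exprSr -mulrA [X in _ * X](_ : _ = Fps (fun n => 'C(n + d, d)%:R)) //.
apply: fpsP => -[|m]; first by rewrite coefs_1BXM0 /= !binn.
by rewrite coefs_1BXMS /= addSn binS natrD addrAC subrr add0r addSnnS.
Qed.

End PowerSeries.

(** * From the recurrence to the generating functions *)

Definition H_tail r d : fps rat :=
  H r - \sum_(0 <= j < d) (h r j)%:R * fpsX rat ^+ j.

Lemma coefs_H_tail r d n :
  coefs (H_tail r d) n = if (d <= n)%N then (h r n)%:R else 0.
Proof.
rewrite coefsB coefs_sum big_mkord.
under eq_bigr => j _ do rewrite coefsMn coefsXn.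
case: leqP => [le_dn|lt_nd].
  by rewrite big1 ?subr0 // => j _; rewrite gtn_eqF ?mulr0 // (leq_trans _ le_dn).
rewrite (bigD1 (Ordinal lt_nd)) //= eqxx mulr1 big1 ?addr0 ?subrr // => j.
by rewrite -val_eqE eq_sym /= => /negbTE ->; rewrite mulr0.
Qed.

(** Coefficientwise this is [h_rec], with [h0] and [h1] as initial values. *)
Lemma H_functional r :
  (1 - fpsX rat) * H r = (r == 0%N)%:R +
    fpsX rat ^+ 2 * \sum_(d < r.+1) H_tail (r - d) d / (1 - fpsX rat) ^+ d.+1.
Proof.
set S := \sum_(d < _) _.
apply: fpsP => n; rewrite coefsD -[_%:R in RHS]mulr1 coefsMn coefs1.
rewrite expr2 -mulrA; case: n => [|[|n]].
- by rewrite coefs_1BXM0 coefsXM0 addr0 mulr1 [LHS]/= h0.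
- by rewrite coefs_1BXMS coefsXMS coefsXM0 addr0 mulr0 [X in X - _]/= h1 subrr.
rewrite coefs_1BXMS !coefsXMS mulr0 add0r [X in X - _]/= h_rec natrD addrC addKr.
rewrite coefs_sum natr_sum.
under eq_bigr => a _ do rewrite natr_sum (sum_ord_swap_bound
  (fun d => (h (r - d) (a + d) * 'C(n - a, d))%:R : rat)).
rewrite (exchange_big_dep xpredT) //; apply: eq_bigr => d _.
rewrite coefsM; under [RHS]eq_bigr => i _ do
  rewrite coefs_H_tail coefs_inv_1BX (fun_if ( *%R^~ _)) mul0r -natrM.
(* Substituting i = a + d turns the truncation [d <= i] into the range of [a]. *)
rewrite -[RHS]big_mkcond -[RHS](big_geq_mkord _ _ xpredT
  (fun i => (h (r - d) i * 'C(n - i + d, d))%:R)).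
rewrite -[X in index_iota X _]add0n big_addn big_mkord.
rewrite (big_ord_widen n.+1 (fun i =>
  (h (r - d) (i + d) * 'C(n - (i + d) + d, d))%:R)) ?leq_subr //.
apply: eq_big => a; first by have := ltn_ord a; lia.
by move=> le_dna; rewrite (_ : n - (a + d) + d = n - a)%N //; lia.
Qed.

Theorem theorem4p7 (r : nat) :
  let x : fps rat := fpsX rat in
  H r = (1 - x) / (1 - 2%:R * x) * (r == 0%N)%:R
        + x ^+ 2 / (1 - 2%:R * x)
          * \sum_(1 <= d < r.+1)
              (H (r - d) - \sum_(0 <= j < d) (h (r - d) j)%:R * x ^+ j)
              / (1 - x) ^+ d.
Proof.
move=> x.
have u1 : 1 - x \is a GRing.unit := unit_1BX _.
have u2 : 1 - 2%:R * x \is a GRing.unit := unit_1B2X _.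
set S := \sum_(1 <= d < r.+1) _.
have mulVX k f : (1 - x) * (f / (1 - x) ^+ k.+1) = f / (1 - x) ^+ k.
  by rewrite mulrCA exprSr invrM ?unitrX // mulVKr.
(* A second factor 1 - x turns the [d = 0] term into [H r] and the others into [S]. *)
have HS : (1 - x) ^+ 2 * H r = (1 - x) * (r == 0%N)%:R + x ^+ 2 * (H r + S).
  rewrite expr2 -mulrA H_functional mulrDr mulrCA; congr (_ + _ * _).
  rewrite mulr_sumr big_ord_recl mulVX expr0 divr1 /H_tail subn0 big_geq // subr0.
  rewrite /S big_add1 big_mkord; congr (_ + _); apply: eq_bigr => d _.
  by rewrite mulVX.
have mulVY f g : (1 - 2%:R * x) * (f / (1 - 2%:R * x) * g) = f * g.
  by rewrite mulrA mulrCA divrr // mulr1.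
apply: (mulrI u2); rewrite mulrDr !mulVY.
(* Moving [x ^+ 2 * H r] to the left produces the denominator. *)
have -> : 1 - 2%:R * x = (1 - x) ^+ 2 - x ^+ 2 by ring.
by rewrite mulrBl HS mulrDr addrA addrAC addrK.
Qed.
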